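(* Let $k$ be a field of characteristic zero. Let $\mathfrak{g}=\mathfrak{a}\rtimes_{\phi}\mathfrak{b}$ be a semidirect product of an abelian Lie algebra $\mathfrak{a}$ and a Lie algebra $\mathfrak{b}$ over $k$ by a representation $\phi\colon\mathfrak{b}\to\mathrm{End}(\mathfrak{a})=\mathrm{Der}(\mathfrak{a})$, so that there is a split exact sequence $0\to\mathfrak{a}\to\mathfrak{g}\to\mathfrak{b}\to 0$. If $\mathfrak{b}$ admits an LSA-product, then $\mathfrak{g}$ also admits an LSA-product. If $\mathfrak{b}$ admits a Novikov product $(x,y)\mapsto x\cdot y$ such that $\phi(x\cdot y)=0$ for all $x,y\in\mathfrak{b}$, then $\mathfrak{g}$ also admits a Novikov product.
   Context: The Lie bracket on $\mathfrak{g}=\mathfrak{a}\times\mathfrak{b}$ is $[(a,x),(b,y)]=(\phi(x)b-\phi(y)a,[x,y])$ for $a,b\in\mathfrak{a}$, $x,y\in\mathfrak{b}$. An LSA-product (affine structure) on a Lie algebra $\mathfrak{h}$ over $k$ is a $k$-bilinear product $(x,y)\mapsto x\cdot y$ on $\mathfrak{h}$ satisfying $x\cdot(y\cdot z)-(x\cdot y)\cdot z=y\cdot(x\cdot z)-(y\cdot x)\cdot z$ and $[x,y]=x\cdot y-y\cdot x$ for all $x,y,z\in\mathfrak{h}$. A Novikov product (Novikov structure) on $\mathfrak{h}$ is an LSA-product satisfying in addition $(x\cdot y)\cdot z=(x\cdot z)\cdot y$ for all $x,y,z\in\mathfrak{h}$. *)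

(* Defs.v *)
From HB Require Import structures.
From mathcomp Require Import all_boot all_order all_algebra.

Set Implicit Arguments.
Unset Strict Implicit.
Unset Printing Implicit Defensive.

Import GRing.Theory.
Local Open Scope ring_scope.

HB.mixin Record isLieAlgebra (k : fieldType) V of GRing.Lmodule k V := {
  lie : V -> V -> V;
  lie_bilinear : bilinear_for *:%R *:%R lie;
  lie_alternating : forall x, lie x x = 0;
  lie_jacobi : forall x y z,
    lie x (lie y z) + lie y (lie z x) + lie z (lie x y) = 0
}.

#[short(type="lieAlgType")]
HB.structure Definition LieAlgebra (k : fieldType) :=
  {V of isLieAlgebra k V & GRing.Lmodule k V}.

Notation "[ 'lie' x , y ]" := (lie x y)
  (at level 0, x at level 99, y at level 99, format "[ 'lie'  x ,  y ]")
  : ring_scope.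

Section Definitions.
Variable k : fieldType.

Definition lie_abelian (L : lieAlgType k) : Prop :=
  forall x y : L, [lie x, y] = 0.

Definition lie_morphism (L M : lieAlgType k) (f : L -> M) : Prop :=
  linear f /\ forall x y : L, f [lie x, y] = [lie f x, f y].

Definition lie_derivation (L : lieAlgType k) (D : L -> L) : Prop :=
  linear D /\ forall x y : L, D [lie x, y] = [lie D x, y] + [lie x, D y].

Lemma abelian_lie_derivation (L : lieAlgType k) (D : {linear L -> L}) :
  lie_abelian L -> lie_derivation D.
Proof.
move=> L_abelian; split=> [c x y|x y]; first exact: linearP.
by rewrite !L_abelian linear0 addr0.
Qed.

(* A representation L -> End(V), uncurried: bilinearity of the action says that
   each [phi x] is a linear endomorphism of V and that [phi] is linear in x. *)
Record representation (L : lieAlgType k) (V : lmodType k) := Representation {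
  repr_act :> {bilinear L -> V -> V};
  repr_lie : forall (x y : L) (v : V),
    repr_act [lie x, y] v =
      repr_act x (repr_act y v) - repr_act y (repr_act x v)
}.

Definition LSA_product (L : lieAlgType k) (m : {bilinear L -> L -> L}) : Prop :=
  (forall x y z : L, m x (m y z) - m (m x y) z = m y (m x z) - m (m y x) z) /\
  (forall x y : L, [lie x, y] = m x y - m y x).

Definition Novikov_product (L : lieAlgType k) (m : {bilinear L -> L -> L}) :
    Prop :=
  LSA_product m /\ forall x y z : L, m (m x y) z = m (m x z) y.

Definition admits_LSA_product (L : lieAlgType k) : Prop :=
  exists m : {bilinear L -> L -> L}, LSA_product m.

Definition admits_Novikov_product (L : lieAlgType k) : Prop :=
  exists m : {bilinear L -> L -> L}, Novikov_product m.

End Definitions.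

(* An alias of the product module, indexed by the representation so that the
   Lie algebra instance on it is determined by its type. *)
Definition semidirect (k : fieldType) (a b : lieAlgType k)
  (phi : representation b a) : Type := (a * b)%type.

Section Semidirect.
Variables (k : fieldType) (a b : lieAlgType k) (phi : representation b a).

HB.instance Definition _ := GRing.Lmodule.copy (semidirect phi) (a * b)%type.

(* The bracket of a is absent since a is meant to be abelian. *)
Definition semidirect_lie (u v : semidirect phi) : semidirect phi :=
  (phi u.2 v.1 - phi v.2 u.1, [lie u.2, v.2]).

Lemma semidirect_lie_bilinear : bilinear_for *:%R *:%R semidirect_lie.
Proof.
have [lieL lieR] := lie_bilinear (s := b).
split=> [w c u v|w c u v]; congr pair => /=.
- by rewrite linearPl linearPr /= opprD addrACA scalerBr.
- exact: lieL.
- by rewrite linearPl linearPr /= opprD addrACA scalerBr.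
- exact: lieR.
Qed.

Lemma semidirect_lie_alternating u : semidirect_lie u u = 0.
Proof. by congr pair; rewrite /= ?subrr ?lie_alternating. Qed.

Lemma semidirect_lie_jacobi u v w :
  semidirect_lie u (semidirect_lie v w) + semidirect_lie v (semidirect_lie w u)
    + semidirect_lie w (semidirect_lie u v) = 0.
Proof.
case: u v w => [u x] [v y] [w z]; congr pair => /=; last exact: lie_jacobi.
rewrite !repr_lie !linearBr /= !opprB.
set A := phi x (phi y w); set B := phi x (phi z v); set C := phi y (phi z u).
set D := phi z (phi y u); set E := phi y (phi x w); set F := phi z (phi x v).
rewrite (addrACA A) (addrACA C) (addrACA F) -!opprD.
by rewrite (addrC C B) (addrC F E) (addrC D A) !subrKA subrr.
Qed.

HB.instance Definition _ := isLieAlgebra.Build k (semidirect phi)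
  semidirect_lie_bilinear semidirect_lie_alternating semidirect_lie_jacobi.

Definition semidirect_inl (u : a) : semidirect phi := (u, 0).
Definition semidirect_proj (w : semidirect phi) : b := w.2.
Definition semidirect_section (x : b) : semidirect phi := (0, x).

Lemma semidirect_split_exact : lie_abelian a ->
  [/\ lie_morphism semidirect_inl, lie_morphism semidirect_proj,
      lie_morphism semidirect_section & injective semidirect_inl] /\
  ((forall w, semidirect_proj w = 0 <-> exists u, w = semidirect_inl u) /\
   cancel semidirect_section semidirect_proj).
Proof.
move=> a_abelian; split; first split.
- split=> [c u v|u v]; congr pair => /=; rewrite ?scaler0 ?addr0 //.
    by rewrite a_abelian !linear0l subrr.
  by rewrite lie_alternating.
- by split.
- split=> [c x y|x y]; congr pair => /=; rewrite ?scaler0 ?addr0 //.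
  by rewrite !linear0r subrr.
- by move=> u v [].
split=> // -[u x]; split=> [/= ->|[v [_ ->]]] //.
by exists u.
Qed.

End Semidirect.

(* Main.v *)
Require Import Defs.
From HB Require Import structures.
From mathcomp Require Import all_boot all_order all_algebra.

(** On the semidirect product of a by b, put
      (u, x) . (v, y) = (phi x v, x . y),
    that is, let a carry the zero product, let b act on a from the left through
    phi and let a act trivially on b.  The commutator of this product is the
    semidirect bracket by inspection.  The a-component of the left-symmetry
    identity reads
      phi x (phi y w) - phi (x . y) w = phi y (phi x w) - phi (y . x) w,
    which, as x . y - y . x = [x, y], is exactly the statement that phi is a
    representation.  The a-component of the Novikov identity reads
    phi (x . y) w = phi (x . z) v, with v and w independent of each other: this
    is why phi has to vanish on the products of b. *)

Set Implicit Arguments.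
Unset Strict Implicit.
Unset Printing Implicit Defensive.

Import GRing.Theory.
Local Open Scope ring_scope.

Section SemidirectProduct.
Variables (k : fieldType) (a b : lieAlgType k) (phi : representation b a).
Variable m : {bilinear b -> b -> b}.

Definition semidirect_mul (u v : semidirect phi) : semidirect phi :=
  (phi u.2 v.1, m u.2 v.2).

Lemma semidirect_mul_bilinear : bilinear_for *:%R *:%R semidirect_mul.
Proof.
split=> [w c u v|w c u v]; congr pair => /=.
- exact: linearPl.
- exact: linearPl.
- exact: linearPr.
- exact: linearPr.
Qed.

HB.instance Definition _ :=
  bilinear_isBilinear.Build k (semidirect phi) (semidirect phi)
    (semidirect phi) *:%R *:%R semidirect_mul semidirect_mul_bilinear.

Lemma semidirect_mul_LSA : LSA_product m -> LSA_product semidirect_mul.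
Proof.
move=> [m_lsym m_lie]; split=> [[u x] [v y] [w z]|[u x] [v y]];
  congr pair => /=; last exact: m_lie.
  (* The difference of the two associators measures how far phi is from being a
     representation. *)
  have := repr_lie phi x y w; rewrite m_lie linearBl => phi_lie.
  by apply/eqP; rewrite subr_eq addrAC -addrA phi_lie addrC subrK.
exact: m_lsym.
Qed.

Lemma semidirect_mul_Novikov :
    Novikov_product m -> (forall x y u, phi (m x y) u = 0) ->
  Novikov_product semidirect_mul.
Proof.
move=> [m_LSA m_rcomm] phi_m0; split; first exact: semidirect_mul_LSA.
by move=> [u x] [v y] [w z]; congr pair => /=; rewrite ?phi_m0.
Qed.

End SemidirectProduct.

Theorem corollary4p4 (k : fieldType) (char_k : [pchar k] =i pred0)
    (a b : lieAlgType k) (a_abelian : lie_abelian a)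
    (phi : representation b a) :
  (admits_LSA_product b -> admits_LSA_product (semidirect phi)) /\
  ((exists m : {bilinear b -> b -> b},
      Novikov_product m /\ forall (x y : b) (u : a), phi (m x y) u = 0) ->
   admits_Novikov_product (semidirect phi)).
Proof.
split=> [[m m_LSA]|[m [m_Nov phi_m0]]]; exists (semidirect_mul (phi := phi) m).
- exact: semidirect_mul_LSA.
- exact: semidirect_mul_Novikov.
Qed.
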